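(* For $\alpha\in\mathbb{T}$ define the selfadjoint matrix $$\delta_\alpha=\begin{bmatrix} 0 & \overline{\alpha} \\ \alpha & 0 \end{bmatrix}.$$ For $0<\varepsilon<1$ let $w^{\alpha,\varepsilon}=(I+\varepsilon\delta_\alpha)^{1/2}$ and $X=\ell^2_{w^{\alpha,\varepsilon}}$ (a norm on $\mathbb{C}^2$). Consider the weight $W^{\alpha,\varepsilon}$ and the interpolation family generated by it: $$W^{\alpha,\varepsilon}(\gamma)=\begin{cases} I+\varepsilon\delta_\alpha, & \gamma\in Q_1 \\ (I+\varepsilon\overline{\delta_\alpha})^{-1}, & \gamma\in Q_2 \\ (I+\varepsilon\delta_\alpha)^{-1}, & \gamma\in Q_3 \\ I+\varepsilon\overline{\delta_\alpha}, & \gamma\in Q_4 \end{cases}\qquad \widetilde{Z^{\alpha,\varepsilon}_\gamma}=\begin{cases} X, & \gamma\in Q_1 \\ X^*, & \gamma\in Q_2 \\ \overline{X}^*, & \gamma\in Q_3 \\ \overline{X}, & \gamma\in Q_4 \end{cases}$$ (so $\widetilde{Z^{\alpha,\varepsilon}_\gamma}=\ell^2_{W^{\alpha,\varepsilon}(\gamma)^{1/2}}$). There exist $\alpha\in\mathbb{T}$ and $0<\varepsilon_0<1$ such that if $0<\varepsilon<\varepsilon_0$ then $$\widetilde{Z^{\alpha,\varepsilon}}[0]\neq\ell_2^2 .$$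
   Context: $\mathbb{D}$ is the open unit disc, $\mathbb{T}$ the unit circle. $Q_j=\{e^{i\theta}:\frac{(j-1)\pi}{2}<\theta<\frac{j\pi}{2}\}$, $1\le j\le4$, is the open arc of $\mathbb{T}$ in the $j$-th quadrant. For a matrix $A$, $\overline{A}$ is the entrywise complex conjugate. For $A\in GL_N(\mathbb{C})$, $\ell^2_A=(\mathbb{C}^N,\|\cdot\|_A)$ with $\|x\|_A=\|Ax\|_{\ell_2^N}$; $\ell_2^N$ is $\mathbb{C}^N$ with the Euclidean norm. Duals are identified with $\mathbb{C}^N$ through the bilinear pairing $(x,y)=\sum_nx_ny_n$, and the complex conjugate space $\overline{X}$ of $X=(\mathbb{C}^N,\|\cdot\|_X)$ is identified with $\mathbb{C}^N$ with norm $x\mapsto\|\bar x\|_X$. Under these identifications $(\ell^2_A)^*=\ell^2_{A^{-T}}$ ($A^{-T}$ the inverse of the transpose), $\overline{\ell^2_A}=\ell^2_{\overline{A}}$ and $\overline{\ell^2_A}^*=\ell^2_{(A^* )^{-1}}$. For a family of norms $E_\gamma=(\mathbb{C}^N,\|\cdot\|_\gamma)$, measurable in $\gamma$ and uniformly equivalent to the Euclidean norm, the interpolated space $E[0]$ is $\mathbb{C}^N$ with norm $\|x\|_{E[0]}=\inf\{\operatorname{ess\,sup}_{\gamma}\|f(\gamma)\|_{\gamma}\}$, the infimum over bounded analytic $f:\mathbb{D}\to\mathbb{C}^N$ with $f(0)=x$ ($f(\gamma)$ being the boundary values). The conclusion means that the norms differ on $\mathbb{C}^2$. *)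

(* Defs.v *)
From HB Require Import structures.
From mathcomp Require Import all_boot all_order all_algebra.
From mathcomp Require Import all_classical all_reals all_analysis.
From mathcomp Require Import ess_sup_inf complex.

Set Implicit Arguments.
Unset Strict Implicit.
Unset Printing Implicit Defensive.

Import Order.TTheory GRing.Theory Num.Theory.
Import numFieldNormedType.Exports.
Import ComplexField.Normc.

Local Open Scope classical_set_scope.
Local Open Scope ring_scope.
Local Open Scope complex_scope.

Section norms.
Context {R : realType} {N : nat}.
Implicit Types (x y : 'cV[R[i]]_N) (A : 'M[R[i]]_N) (nrm : 'cV[R[i]]_N -> R).

Definition l2norm x : R := Num.sqrt (\sum_(i < N) normc (x i 0) ^+ 2).

Definition ellnorm A x : R := l2norm (A *m x).

(* Duality is with respect to the bilinear, not sesquilinear, pairing. *)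
Definition dualnorm nrm y : R :=
  sup [set normc (\sum_(i < N) x i 0 * y i 0) | x in [set x | nrm x <= 1]].

Definition conjnorm nrm x : R := nrm (map_mx conjc x).

(* Unitary functional calculus; for A positive semidefinite this is the
   positive semidefinite square root, since sqrtC is nonnegative there. *)
Definition sqrtmx A : 'M[R[i]]_N :=
  invmx (spectralmx A) *m diag_mx (map_mx sqrtC (spectral_diag A))
    *m spectralmx A.

End norms.

Section circle.
Context {R : realType}.

Definition cis (t : R) : R[i] := cos t +i* sin t.

Definition quadrant_arc (j : nat) : set R[i] :=
  cis @` `](j%:R - 1) * pi / 2, j%:R * pi / 2[.

(* Arc length on the unit circle, through the parametrization cis. *)
Definition arc_measure : {measure set (measurableTypeR R) -> \bar R} :=
  mrestr (@lebesgue_measure R) (measurable_itv `]0, 2 * pi[).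

End circle.

Section interpolation.
Context {R : realType} {N : nat}.
Implicit Types (f g : R[i] -> 'cV[R[i]]_N) (E : R[i] -> 'cV[R[i]]_N -> R).

Definition analytic_on_disc f : Prop := forall z : R[i], `|z| < 1 ->
  forall i : 'I_N, derivable (fun w : R[i]^o => f w i 0 : R[i]^o) z 1.

Definition bounded_on_disc f : Prop :=
  exists M : R, forall z : R[i], `|z| < 1 -> l2norm (f z) <= M.

(* By Fatou's theorem every bounded analytic f has such a g, which is unique
   up to a null set. *)
Definition boundary_values f g : Prop :=
  {ae @arc_measure R, forall t : measurableTypeR R, forall i : 'I_N,
    (f (r%:C * cis t) i 0 : R[i]^o) @[r --> (1 : R)^'-]
      --> (g (cis t) i 0 : R[i]^o)}.

(* The norm of E[0]; the values of f outside the open disc play no role. *)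
Definition interp0 E (x : 'cV[R[i]]_N) : \bar R :=
  ereal_inf [set v | exists f g,
    [/\ analytic_on_disc f, bounded_on_disc f, boundary_values f g, f 0 = x &
        v = ess_sup (@arc_measure R)
              (fun t : measurableTypeR R => (E (cis t) (g (cis t)))%:E)]].

End interpolation.

Section family.
Context {R : realType}.
Implicit Types (alpha gamma : R[i]) (eps : R).

Definition delta alpha : 'M[R[i]]_2 :=
  \matrix_(i, j) (if (i < j)%N then alpha^*
                  else if (j < i)%N then alpha else 0).

Definition Xnorm alpha eps : 'cV[R[i]]_2 -> R :=
  ellnorm (sqrtmx (1%:M + eps%:C *: delta alpha)).

(* The values of weight and Zfam off the four open arcs are irrelevant, as these
   cover the circle up to four points. *)
Definition weight alpha eps gamma : 'M[R[i]]_2 :=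
  if gamma \in quadrant_arc 1 then 1%:M + eps%:C *: delta alpha
  else if gamma \in quadrant_arc 2 then
    invmx (1%:M + eps%:C *: map_mx conjc (delta alpha))
  else if gamma \in quadrant_arc 3 then invmx (1%:M + eps%:C *: delta alpha)
  else if gamma \in quadrant_arc 4 then
    1%:M + eps%:C *: map_mx conjc (delta alpha)
  else 1%:M.

Definition Zfam alpha eps gamma : 'cV[R[i]]_2 -> R :=
  if gamma \in quadrant_arc 1 then Xnorm alpha eps
  else if gamma \in quadrant_arc 2 then dualnorm (Xnorm alpha eps)
  else if gamma \in quadrant_arc 3 then dualnorm (conjnorm (Xnorm alpha eps))
  else if gamma \in quadrant_arc 4 then conjnorm (Xnorm alpha eps)
  else l2norm.

End family.

(* Main.v *)
(* Only an upper bound on the interpolation norm of the first basis vector e1 is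
   needed: a test function f with f(0) = e1 and ess sup of the norms below 1.
   Take alpha = exp(i pi/4). Up to the scalar 1 (right half circle) or
   1/(1 - eps^2) (left half circle) the weight on the j-th arc is
   I + eps delta_psi, where psi(t) = exp(i pi/4 (2j - 1)) follows gamma = exp(it)
   up to an angle at most pi/4. For f(z) = (1 + eps^2 g(z), - eps a z) with g
   analytic, g(0) = 0,
     <W f, f> = 1 + eps^2 (2 Re g + |psi - a gamma|^2 - 1 + w) + O(eps^4),
   w being 0 on the right and 1 on the left. The mean of |psi - a gamma|^2 can be
   made as small as 1 - 8/pi^2 < 1/2, so the bracket without g has negative mean,
   and a polynomial g makes it uniformly negative.
   The identification of the family with the weight comes from C^* C being
   positive semidefinite: its square root defines the same norm as C. *)

Require Import Defs.
From mathcomp Require Import all_boot all_order all_algebra.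
From mathcomp Require Import all_classical all_reals all_analysis.
From mathcomp Require Import ess_sup_inf complex ring lra.
Import Order.TTheory GRing.Theory Num.Theory.
Import numFieldNormedType.Exports.
Import ComplexField.Normc.
Local Open Scope ring_scope.
Local Open Scope complex_scope.

Set Implicit Arguments.
Unset Strict Implicit.
Unset Printing Implicit Defensive.

(** * Gram matrices and positive square roots *)

Definition adjmx {R : realType} {m n : nat} (A : 'M[R[i]]_(m, n)) := (map_mx conjc A)^T.

Lemma normc_sqr {R : realType} (z : R[i]) : (normc z ^+ 2)%:C = conjc z * z.
Proof.
case: z => a b; rewrite /= sqr_sqrtr ?addr_ge0 ?sqr_ge0 //.
by simpc; congr (_ +i* _); ring.
Qed.

Lemma conjcE {R : realType} : (@conjc R : R[i] -> R[i]) = (Num.conj : R[i] -> R[i]).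
Proof. reflexivity. Qed.

Section adj.
Context {R : realType}.

Lemma adjmxK m n (A : 'M[R[i]]_(m, n)) : adjmx (adjmx A) = A.
Proof. by apply/matrixP => i j; rewrite !mxE conjcK. Qed.

Lemma adjmxM m n p (A : 'M[R[i]]_(m, n)) (B : 'M[R[i]]_(n, p)) :
  adjmx (A *m B) = adjmx B *m adjmx A.
Proof. by rewrite /adjmx map_mxM trmx_mul. Qed.

Lemma adj_diag_mx n (d : 'rV[R[i]]_n) : adjmx (diag_mx d) = diag_mx (map_mx conjc d).
Proof. by rewrite /adjmx map_diag_mx tr_diag_mx. Qed.

Lemma l2norm_ge0 n (x : 'cV[R[i]]_n) : 0 <= l2norm x.
Proof. exact: sqrtr_ge0. Qed.

Lemma l2normsqr n (x : 'cV[R[i]]_n) : l2norm x ^+ 2 = \sum_(i < n) normc (x i 0) ^+ 2.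
Proof. by rewrite sqr_sqrtr // sumr_ge0 // => i _; exact: sqr_ge0. Qed.

Lemma l2normE n (x : 'cV[R[i]]_n) : (l2norm x ^+ 2)%:C = (adjmx x *m x) 0 0.
Proof.
rewrite l2normsqr rmorph_sum mxE; apply: eq_bigr => i _.
by rewrite !mxE -normc_sqr.
Qed.

Lemma ellnormE n (A : 'M[R[i]]_n) x :
  (ellnorm A x ^+ 2)%:C = (adjmx x *m (adjmx A *m A) *m x) 0 0.
Proof. by rewrite l2normE adjmxM !mulmxA. Qed.

Lemma eq_ellnorm n (A B : 'M[R[i]]_n) :
  adjmx A *m A = adjmx B *m B -> ellnorm A =1 ellnorm B.
Proof.
move=> AB x; apply/eqP; rewrite -(@eqrXn2 _ 2) ?l2norm_ge0 //.
apply/eqP/(@complexI R).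
by rewrite (ellnormE A) (ellnormE B) AB.
Qed.

(** By the spectral theorem [A] is [P^* D P] with [P] unitary. The entries of [D] are nonnegative,
    so their roots are real and [sqrtmx A] is selfadjoint with square [A]; both norms therefore come
    from the same Gram matrix. *)
Lemma ellnorm_sqrtmx n (C : 'M[R[i]]_n) :
  ellnorm (sqrtmx (adjmx C *m C)) =1 ellnorm C.
Proof.
apply: eq_ellnorm; set A := adjmx C *m C.
have hA : adjmx A = A by rewrite adjmxM adjmxK.
have conjtrE (B : 'M[R[i]]_n) : map_mx Num.conj B^T = adjmx B by rewrite -map_trmx.
have nA : A \is normalmx by apply/normalmxP; rewrite conjtrE hA.
have PU := spectral_unitarymx A.
have := unitarymx_unit PU; move: PU (orthomx_spectralP nA).
rewrite /sqrtmx; set P := spectralmx A; set d := spectral_diag A => PU AE Pu.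
have PV : invmx P = adjmx P by rewrite invmx_unitary // conjtrE.
have PP : P *m adjmx P = 1%:M by rewrite -PV mulmxV.
(* [D] is itself a Gram matrix, so its diagonal entries are sums of squared moduli. *)
have dE : diag_mx d = adjmx (C *m adjmx P) *m (C *m adjmx P).
  rewrite adjmxM adjmxK mulmxA -[P *m _ *m C]mulmxA -/A AE PV.
  by rewrite !mulmxA PP mul1mx -mulmxA PP mulmx1.
have d_ge0 i : 0 <= d 0 i.
  have /matrixP/(_ i i) := dE; rewrite !mxE eqxx mulr1n => ->.
  by apply: sumr_ge0 => j _; rewrite !mxE -normc_sqr ler0c sqr_ge0.
rewrite !adjmxM adj_diag_mx PV adjmxK -!mulmxA (mulmxA P) PP mul1mx.
rewrite (mulmxA (diag_mx _)) mulmx_diag [RHS]AE PV -mulmxA; congr (_ *m (diag_mx _ *m _)).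
apply/rowP => i; rewrite !mxE conjcE geC0_conj ?sqrtC_ge0 //.
by rewrite -expr2 sqrtCK.
Qed.
End adj.

(** * Conjugate and dual norms *)

Section dual.
Context {R : realType} {n : nat}.
Implicit Types (u w x y : 'cV[R[i]]_n) (S : 'M[R[i]]_n).

Lemma normc_conj (z : R[i]) : normc (conjc z) = normc z.
Proof. by case: z => a b /=; rewrite sqrrN. Qed.

Lemma normc_real (c : R) : normc c%:C = `|c|.
Proof. by rewrite /= expr0n addr0 sqrtr_sqr. Qed.

Lemma conjnorm_ellnorm S : conjnorm (ellnorm S) =1 ellnorm (map_mx conjc S).
Proof.
move=> x; rewrite /conjnorm /ellnorm /l2norm; congr Num.sqrt.
apply: eq_bigr => i _; congr (_ ^+ 2).
have -> : S *m map_mx conjc x = map_mx conjc (map_mx conjc S *m x).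
  rewrite map_mxM -map_mx_comp (_ : map_mx _ S = S) //.
  by apply/matrixP => k j; rewrite !mxE /= conjcK.
by rewrite mxE normc_conj.
Qed.

Lemma l2norm_eq0 w : l2norm w = 0 -> w = 0.
Proof.
move=> /eqP; rewrite -sqrf_eq0 l2normsqr psumr_eq0; last by move=> *; exact: sqr_ge0.
move=> /allP w0; apply/colP => i; rewrite mxE.
have /implyP/(_ isT) := w0 i (mem_index_enum i).
by rewrite sqrf_eq0 => /eqP/eq0_normc.
Qed.

Lemma normc_dot_le u w :
  l2norm u <= 1 -> normc (\sum_(i < n) u i 0 * w i 0) <= l2norm w.
Proof.
move=> u1; have [w0|/eqP w0] := eqVneq (l2norm w) 0.
  rewrite (l2norm_eq0 w0) big1 ?normc0 ?l2norm_ge0 // => i _.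
  by rewrite mxE mulr0.
have {w0} w_gt0 : 0 < l2norm w by rewrite lt_def l2norm_ge0 andbT; apply/eqP.
have u2 : \sum_(i < n) normc (u i 0) ^+ 2 <= 1.
  by rewrite -l2normsqr -[1](expr1n _ 2) lerXn2r ?nnegrE ?l2norm_ge0.
have lesum : normc (\sum_(i < n) u i 0 * w i 0)
    <= \sum_(i < n) normc (u i 0) * normc (w i 0).
  elim/big_ind2 : _ => [|a b c d ab cd|i _]; rewrite ?normc0 ?normcM //.
  by rewrite (le_trans (le_normcD _ _)) // lerD.
apply: (le_trans lesum).
(* AM-GM: [2 a b <= a^2 W + b^2 / W], summed with [sum a^2 <= 1], [sum b^2 = W^2]. *)
have : \sum_(i < n) normc (u i 0) * normc (w i 0) <=
  \sum_(i < n) (normc (u i 0) ^+ 2 * (l2norm w / 2) + normc (w i 0) ^+ 2 * (2 * l2norm w)^-1).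
  apply: ler_sum => i _; rewrite -subr_ge0.
  rewrite (_ : _ - _ = (normc (u i 0) * l2norm w - normc (w i 0)) ^+ 2 / (2 * l2norm w)).
    by rewrite divr_ge0 ?sqr_ge0 // mulr_ge0 // ltW.
  by field; rewrite gt_eqF.
move=> /le_trans; apply.
rewrite big_split /= -!mulr_suml -(l2normsqr w).
rewrite (_ : l2norm w ^+ 2 * (2 * l2norm w)^-1 = l2norm w / 2); last first.
  by field; rewrite gt_eqF.
nra.
Qed.

(** The substitution [u = S x] turns the pairing of [x] with [y] into that of [u] with [w], over the
    Euclidean unit ball. Cauchy-Schwarz bounds it by the norm of [w], and the normalised conjugate
    of [w] attains the bound. *)
Lemma dualnorm_ellnorm S : S \in unitmx ->
  dualnorm (ellnorm S) =1 ellnorm (invmx S)^T.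
Proof.
move=> Su y; set w := (invmx S)^T *m y.
have dotE x : \sum_(i < n) x i 0 * y i 0 = \sum_(i < n) (S *m x) i 0 * w i 0.
  transitivity ((x^T *m y) 0 0); first by rewrite mxE; apply: eq_bigr => i _; rewrite mxE.
  transitivity (((S *m x)^T *m w) 0 0); last first.
    by rewrite mxE; apply: eq_bigr => i _; rewrite !mxE.
  by rewrite trmx_mul -mulmxA (mulmxA S^T) -trmx_mul mulVmx // trmx1 mul1mx.
rewrite /dualnorm /ellnorm -/w; apply/eqP; rewrite eq_le; apply/andP; split.
  apply: ge_sup.
    exists (normc (\sum_(i < n) (0 : 'cV[R[i]]_n) i 0 * y i 0)), 0 => //=.
    by rewrite mulmx0 /l2norm big1 ?sqrtr0 // => i _; rewrite mxE normc0 expr0n.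
  by move=> _ [x /= x1 <-]; rewrite dotE; exact: normc_dot_le.
apply: ub_le_sup.
  by exists (l2norm w) => _ [x /= x1 <-]; rewrite dotE; exact: normc_dot_le.
clearbody w.
have wwE : \sum_(i < n) conjc (w i 0) * w i 0 = (l2norm w ^+ 2)%:C.
  by rewrite l2normE mxE; apply: eq_bigr => i _; rewrite !mxE.
(* For [w = 0] the inverse of its norm is 0, so the witness is 0 and remains admissible. *)
exists (invmx S *m ((l2norm w)^-1%:C *: map_mx conjc w)) => /=.
  rewrite mulKVmx // -(@ler_pXn2r _ 2) ?nnegrE ?l2norm_ge0 // expr1n l2normsqr.
  under eq_bigr do rewrite !mxE normcM exprMn normc_conj normc_real // real_normK ?num_real //.
  rewrite -mulr_sumr -l2normsqr -exprMn.
  by have [->|w0] := eqVneq (l2norm w) 0; rewrite ?mulr0 ?expr0n ?mulVf ?expr1n.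
rewrite dotE mulKVmx //.
under eq_bigr do rewrite !mxE -mulrA.
rewrite -mulr_sumr wwE -rmorphM normc_real ger0_norm; last first.
  by rewrite mulr_ge0 ?invr_ge0 ?sqr_ge0 ?l2norm_ge0.
by have [->|w0] := eqVneq (l2norm w) 0; rewrite ?expr0n ?mulr0 // expr2 mulKf.
Qed.
End dual.

(** * Conjugation and duality at the level of Gram matrices *)

Section gram.
Context {R : realType} {n : nat}.
Implicit Types (C : 'M[R[i]]_n).

Lemma conj_gram C :
  map_mx conjc (adjmx C *m C) = adjmx (map_mx conjc C) *m map_mx conjc C.
Proof. by rewrite map_mxM /adjmx !map_trmx. Qed.

Lemma ellnorm_sqrt_gram C : ellnorm (sqrtmx (adjmx C *m C)) = ellnorm C.
Proof. exact/funext/ellnorm_sqrtmx. Qed.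

Lemma conjnorm_gram C :
  conjnorm (ellnorm (sqrtmx (adjmx C *m C)))
    = ellnorm (sqrtmx (map_mx conjc (adjmx C *m C))).
Proof.
rewrite (conj_gram C) (ellnorm_sqrt_gram C) (ellnorm_sqrt_gram (map_mx conjc C)).
exact/funext/conjnorm_ellnorm.
Qed.

(** The right-hand side is the Gram matrix of the inverse transpose, which gives the dual norm. The
    conjugate of [C^* C] is [C^T] times the conjugate of [C], and inverting this product reverses
    its factors. *)
Lemma inv_conj_gram C : C \in unitmx ->
  invmx (map_mx conjc (adjmx C *m C)) = adjmx (invmx C)^T *m (invmx C)^T.
Proof.
move=> Cu; have adjE : adjmx (invmx C)^T = invmx (map_mx conjc C).
  by rewrite /adjmx -map_trmx trmxK map_invmx.
have CTu : C^T \in unitmx by rewrite unitmx_tr.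
have Ccu : map_mx conjc C \in unitmx by rewrite map_unitmx.
have XE : map_mx conjc (adjmx C *m C) = C^T *m map_mx conjc C.
  rewrite (conj_gram C); congr (_ *m _).
  by apply/matrixP => i j; rewrite !mxE conjcK.
have Xu : C^T *m map_mx conjc C \in unitmx by rewrite unitmx_mul CTu.
rewrite XE adjE trmx_inv -[LHS]mulmx1 -[RHS](mulKmx Xu); congr (_ *m _).
by rewrite -mulmxA (mulKVmx Ccu) (mulmxV CTu).
Qed.

Lemma dualnorm_gram C : C \in unitmx ->
  dualnorm (ellnorm (sqrtmx (adjmx C *m C)))
    = ellnorm (sqrtmx (invmx (map_mx conjc (adjmx C *m C)))).
Proof.
move=> Cu; rewrite (ellnorm_sqrt_gram C) (inv_conj_gram Cu).
rewrite (ellnorm_sqrt_gram (invmx C)^T).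
exact/funext/dualnorm_ellnorm.
Qed.
End gram.

(** * The matrices I + eps delta *)

Section delta.
Context {R : realType}.
Implicit Types (alpha : R[i]) (eps : R).

Lemma delta_sqr alpha : `|alpha| = 1 -> delta alpha *m delta alpha = 1%:M.
Proof.
move=> a1; have aa : alpha * conjc alpha = 1 by rewrite -sqr_normc a1 expr1n.
apply/matrixP => i j; rewrite !mxE !big_ord_recr big_ord0 /= !mxE /= add0r.
case: i => -[|[|//]] ?; case: j => -[|[|//]] ? /=;
  by rewrite ?mulr0 ?mul0r ?add0r ?addr0 // mulrC.
Qed.

Lemma mul_delta (a b c d alpha : R[i]) : `|alpha| = 1 ->
  (a *: 1%:M + b *: delta alpha) *m (c *: 1%:M + d *: delta alpha) =
  (a * c + b * d) *: 1%:M + (a * d + b * c) *: delta alpha.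
Proof.
move=> a1; rewrite mulmxDl !mulmxDr -!scalemxAl -!scalemxAr !mul1mx !mulmx1.
rewrite (delta_sqr a1) !scalerA !scalerDl -!addrA; congr (_ + _).
by rewrite addrA addrC.
Qed.

Lemma adj_delta alpha : adjmx (delta alpha) = delta alpha.
Proof.
apply/matrixP => i j; rewrite !mxE.
by case: i => -[|[|//]] ?; case: j => -[|[|//]] ? //=; rewrite ?conjcK // oppr0.
Qed.

(** Since [delta alpha] is a selfadjoint involution, the eigenvalues are 1 + eps and 1 - eps. [C] is
    the square root with eigenvalues [s] and [d]. *)
Lemma delta_gram alpha eps : `|alpha| = 1 -> 0 < eps < 1 ->
  exists2 C : 'M[R[i]]_2, C \in unitmx & 1%:M + eps%:C *: delta alpha = adjmx C *m C.
Proof.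
move=> a1 /andP[e0 e1].
pose s := Num.sqrt (1 + eps); pose d := Num.sqrt (1 - eps).
have s2 : s ^+ 2 = 1 + eps by rewrite sqr_sqrtr; lra.
have d2 : d ^+ 2 = 1 - eps by rewrite sqr_sqrtr; lra.
(* [(p + q delta)^2 = p^2 + q^2 + 2 p q delta]. *)
pose p := (s + d) / 2; pose q := (s - d) / 2.
have pq1 : p ^+ 2 + q ^+ 2 = 1.
  have -> : p ^+ 2 + q ^+ 2 = (s ^+ 2 + d ^+ 2) / 2 by rewrite /p /q; field.
  by rewrite s2 d2; field.
have pq2 : p * q + p * q = eps.
  have -> : p * q + p * q = (s ^+ 2 - d ^+ 2) / 2 by rewrite /p /q; field.
  by rewrite s2 d2; field.
pose C := p%:C *: 1%:M + q%:C *: delta alpha.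
have adjC : adjmx C = C.
  rewrite /adjmx map_mxD !map_mxZ map_mx1 linearD !linearZ /= -/(adjmx _) trmx1 adj_delta.
  by rewrite oppr0.
have pqC : p%:C * p%:C + q%:C * q%:C = 1 by rewrite -!rmorphM -rmorphD -!expr2 pq1.
have qpC : p%:C * q%:C + q%:C * p%:C = eps%:C.
  by rewrite -!rmorphM -rmorphD (mulrC q) pq2.
have CC : C *m C = 1%:M + eps%:C *: delta alpha.
  by rewrite (mul_delta _ _ _ _ a1) pqC qpC scale1r.
exists C; last by rewrite adjC CC.
(* [C] is invertible because (I + eps delta)(I - eps delta) is the nonzero scalar 1 - eps^2. *)
have : (C *m C *m (1%:M - eps%:C *: delta alpha)) = (1 - eps ^+ 2)%:C *: 1%:M.
  rewrite CC -scaleNr -[X in (X + _) *m _]scale1r -[X in _ *m (X + _)]scale1r mul_delta //.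
  rewrite !mulr1 !mul1r mulrN addNr scale0r addr0.
  by rewrite -rmorphM -rmorphN -rmorphD.
move=> /(congr1 (mulmx^~ ((1 - eps ^+ 2)^-1%:C *: 1%:M))).
rewrite -[in RHS]scalemxAl mul1mx scalerA -rmorphM divff; last first.
  by rewrite gt_eqF // subr_gt0 expr_lt1 // ltW.
by rewrite rmorph1 scale1r -!mulmxA => /mulmx1_unit[].
Qed.
End delta.

(** * The four arcs and the weight on each of them *)

Section quadrants.
Context {R : realType}.
Implicit Types (gamma alpha : R[i]) (eps : R).

(** With arcs described by signs of coordinates instead of angles, their disjointness is linear
    arithmetic. *)
Definition in_quadrant (j : nat) gamma :=
  match j with
  | 1%N => (0 < complex.Re gamma) && (0 < complex.Im gamma)
  | 2%N => (complex.Re gamma < 0) && (0 < complex.Im gamma)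
  | 3%N => (complex.Re gamma < 0) && (complex.Im gamma < 0)
  | 4%N => (0 < complex.Re gamma) && (complex.Im gamma < 0)
  | _ => false
  end.

(** Shifting the angle by a multiple of pi/2 reduces every arc to the signs of cos and sin on the
    first quadrant. *)
Lemma quadrant_arcP j gamma : (1 <= j <= 4)%N -> quadrant_arc j gamma -> in_quadrant j gamma.
Proof.
move=> j4 [t /= + <-]; rewrite in_itv /= => /andP[t0 t1].
have := @cos_gt0_pihalf R; have := @sin_gt0_pihalf R.
case: j j4 t0 t1 => [//|[|[|[|[|//]]]]] _ t0 t1 sin0 cos0 /=.
- by rewrite sin0 ?cos0; lra.
- rewrite -(subrK (pi / 2) t) cosDpihalf sinDpihalf oppr_lt0.
  by rewrite sin0 ?cos0; lra.
- rewrite -(subrK pi t) cosDpi sinDpi !oppr_lt0.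
  by rewrite sin0 ?cos0; lra.
- rewrite -(subrK pi t) cosDpi sinDpi -(subrK (pi / 2) (t - pi)) cosDpihalf sinDpihalf.
  by rewrite opprK oppr_lt0 sin0 ?cos0; lra.
Qed.

(** This evaluates the nested membership tests in [Zfam] and [weight]. *)
Lemma quadrant_arc_uniq j k gamma : (1 <= j <= 4)%N -> (1 <= k <= 4)%N ->
  quadrant_arc j gamma -> (gamma \in quadrant_arc k) = (k == j).
Proof.
move=> j4 k4 gj; apply/idP/eqP => [|->]; last exact: mem_set.
rewrite inE => /(quadrant_arcP k4); move/(quadrant_arcP j4) : gj.
case: j j4 => [//|[|[|[|[|//]]]]] _; case: k k4 => [//|[|[|[|[|//]]]]] _ //=.
all: by move=> /andP[? ?] /andP[? ?]; exfalso; lra.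
Qed.

Lemma conj_weight alpha eps : map_mx conjc (1%:M + eps%:C *: delta alpha) =
  1%:M + eps%:C *: map_mx conjc (delta alpha).
Proof. by rewrite map_mxD map_mx1 map_mxZ /= oppr0. Qed.

Lemma Zfam_weight alpha eps j gamma x : `|alpha| = 1 -> 0 < eps < 1 -> (1 <= j <= 4)%N ->
  quadrant_arc j gamma -> Zfam alpha eps gamma x = ellnorm (sqrtmx (weight alpha eps gamma)) x.
Proof.
move=> a1 e01 j4 gj; have [C Cu CE] := delta_gram a1 e01.
have CcE : map_mx conjc (map_mx conjc (adjmx C *m C)) = adjmx C *m C.
  by apply/matrixP => i k; rewrite !mxE conjcK.
have Ccu : map_mx conjc C \in unitmx by rewrite map_unitmx.
rewrite /Zfam /weight !(quadrant_arc_uniq _ _ gj) // -!conj_weight /Xnorm CE.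
case: j j4 {gj} => [//|[|[|[|[|//]]]]] _ /=.
- by [].
- by rewrite (dualnorm_gram Cu).
(* Third arc: the dual is taken of the norm given by the conjugate of [C], and the two conjugations
   cancel. *)
- by rewrite (conjnorm_gram C) (conj_gram C) (dualnorm_gram Ccu) -(conj_gram C) CcE.
- by rewrite (conjnorm_gram C).
Qed.
End quadrants.

(** * Polynomial maps as admissible functions in the interpolation norm *)

Section polynomial_maps.
Context {R : realType} {N : nat}.
Implicit Types (P : 'I_N -> {poly R[i]}) (p : {poly R[i]}) (z : R[i]).

Definition polymap P z : 'cV[R[i]]_N := \col_i (P i).[z].

Lemma derivable_hornerC p z : derivable (fun w : R[i]^o => p.[w] : R[i]^o) z 1.
Proof.
elim/poly_ind: p => [|p r ih].
  rewrite (_ : (fun _ => _) = cst (0 : R[i]^o)); first exact: derivable_cst.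
  by apply/funext => w; rewrite horner0.
rewrite (_ : (fun _ => _) = (fun w : R[i]^o => p.[w] : R[i]^o) * id + cst (r : R[i]^o)).
  apply: derivableD; last exact: derivable_cst.
  by apply: derivableM; [exact: ih|exact: derivable_id].
by apply/funext => w; rewrite !hornerE.
Qed.

Lemma continuous_hornerC p : continuous (fun w : R[i]^o => p.[w] : R[i]^o).
Proof.
move=> z; apply: differentiable_continuous.
exact/derivable1_diffP/derivable_hornerC.
Qed.

Lemma polymap_analytic P : analytic_on_disc (polymap P).
Proof.
move=> z _ i; rewrite (_ : (fun _ => _) = (fun w : R[i]^o => (P i).[w] : R[i]^o)).
  exact: derivable_hornerC.
by apply/funext => w; rewrite mxE.
Qed.

Lemma normc_normr (z : R[i]) : (normc z)%:C = `|z|.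
Proof. by []. Qed.

Lemma normc_ge0 (z : R[i]) : 0 <= normc z.
Proof. by case: z => a b; exact: sqrtr_ge0. Qed.

Lemma normc_horner_bounded p : exists M : R, forall z, normc z <= 1 -> normc p.[z] <= M.
Proof.
elim/poly_ind: p => [|p r [M pM]].
  by exists 0 => z _; rewrite horner0 normc0.
exists (M + normc r) => z z1; rewrite hornerMXaddC.
rewrite (le_trans (le_normcD _ _)) // lerD2r normcM.
by rewrite -[M]mulr1 ler_pM ?normc_ge0 ?pM.
Qed.

Lemma polymap_bounded P : bounded_on_disc (polymap P).
Proof.
have [M PM] := choice (fun i => normc_horner_bounded (P i)).
exists (Num.sqrt (\sum_i M i ^+ 2)) => z; rewrite -normc_normr ltcR => /ltW z1.
rewrite ler_sqrt; last by apply: sumr_ge0 => i _; exact: sqr_ge0.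
apply: ler_sum => i _; rewrite mxE lerXn2r ?nnegrE ?normc_ge0 ?PM //.
by rewrite (le_trans _ (PM i _ z1)) ?normc_ge0.
Qed.

Lemma normc_cis (t : R) : normc (cis t) = 1.
Proof. by rewrite /= cos2Dsin2 sqrtr1. Qed.

(** A polynomial is continuous on the whole plane, so its radial limits are its values. *)
Lemma polymap_boundary P : boundary_values (polymap P) (polymap P).
Proof.
apply: aeW => t i /=; rewrite mxE.
under eq_cvg do rewrite mxE.
apply: (@cvg_comp _ _ _ (fun r : R => r%:C * cis t : R[i]^o)
  (fun w : R[i]^o => (P i).[w] : R[i]^o)); last exact: continuous_hornerC.
(* A positive element of [R[i]] is real, so the estimate reduces to 1 - r < e over the reals. *)
apply/cvgrPdist_lt => e; rewrite ltcE /= => /andP[/eqP e_im e_re].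
have {e_im} -> : e = (complex.Re e)%:C by case: e e_im {e_re} => a b /= ->.
near=> r; have -> : cis t - r%:C * cis t = (1 - r)%:C * cis t.
  by rewrite rmorphB rmorph1 mulrBl mul1r.
rewrite normrM.
rewrite -!normc_normr normc_cis mulr1 normc_real ltcR ger0_norm.
  by near: r; exact: nbhs_left_ltBl.
by rewrite subr_ge0 ltW //; near: r; exact: nbhs_left_lt.
Unshelve. all: by end_near. Qed.
End polynomial_maps.

(** * Two inequalities on the quarter circle *)

Section numerics.
Context {R : realType}.
Implicit Types x y : R.

(** With x = |cos t| and y = |sin t|, this is the eps^2 coefficient of the squared norm on the right
    arcs: the first three terms are 2 Re [corrector], and 18/25 is the square of 6/5 [rthalf]. The
    margin 1/50 has to absorb the eps^4 terms. *)
Lemma right_arc_bound x y : 0 <= x -> 0 <= y -> x ^+ 2 + y ^+ 2 = 1 ->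
  (13/20) * x + (9/50) * (x ^+ 2 - y ^+ 2)
    - (39/100) * (x ^+ 4 - 6 * x ^+ 2 * y ^+ 2 + y ^+ 4)
    + 18/25 - (6/5) * (x + y) <= - (1/50).
Proof.
move=> x0 y0 xy; have x2 : x ^+ 2 = 1 - y ^+ 2 by lra.
have y1 : y ^+ 2 <= 1 by have := sqr_ge0 x; lra.
(* [x = sqrt (1 - y^2) >= 1 - y^2/2 - y^4/2] leaves a quartic in [y], which
   has its minimum on [0, 1] near [y = 3/5]. *)
have xlb : (1 - y ^+ 2) * (1 + y ^+ 2 / 2) <= x.
  rewrite -(@ler_pXn2r _ 2) ?nnegrE //; last first.
    by rewrite mulr_ge0 //; have := sqr_ge0 y; lra.
  rewrite x2; move: (y ^+ 2) (sqr_ge0 y) y1 => t t0 t1.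
  suff : 0 <= (1 - t) * (t ^+ 2 * (3 + t)) / 4 by lra.
  by rewrite divr_ge0 // !mulr_ge0 ?sqr_ge0 //; lra.
have -> : x ^+ 4 = (1 - y ^+ 2) ^+ 2 by rewrite -x2; ring.
rewrite x2.
(* Once [xlb] is inserted, the slack in the claim is 569/200 times this product plus a polynomial in
   [y] with nonnegative coefficients. *)
have : 0 <= (y - 3/5) ^+ 2 * (y ^+ 2 + (6/5) * y + 1/80).
  by apply: mulr_ge0; [exact: sqr_ge0 | have := sqr_ge0 y; move: y0; clear; lra].
have := sqr_ge0 y; move: xlb y0; clear; lra.
Qed.

(** The counterpart for the left arcs: the linear term of [corrector] changes sign, and the scale
    1/(1 - eps^2) contributes the extra 1. *)
Lemma left_arc_bound x y : 0 <= x -> 0 <= y -> x ^+ 2 + y ^+ 2 = 1 ->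
  - (13/20) * x + (9/50) * (x ^+ 2 - y ^+ 2)
    - (39/100) * (x ^+ 4 - 6 * x ^+ 2 * y ^+ 2 + y ^+ 4)
    + 18/25 - (6/5) * (x + y) + 1 <= - (1/50).
Proof.
move=> x0 y0 xy; have y2 : y ^+ 2 = 1 - x ^+ 2 by lra.
have x1 : x <= 1 by rewrite -(@ler_pXn2r _ 2) ?nnegrE // expr1n; have := sqr_ge0 y; lra.
have P0 : 0 <= x * y by rewrite mulr_ge0.
have P1 : x * y <= 1/2 by have := sqr_ge0 (x - y); lra.
(* Chord bound for the concave function [sqrt (1 + 2 P)] of [P = x y] on [0, 1/2]. *)
have slb : 1 + (207/250) * (x * y) <= x + y.
  rewrite -(@ler_pXn2r _ 2) ?nnegrE; [|by []|lra|lra].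
  rewrite (_ : (x + y) ^+ 2 = (x ^+ 2 + y ^+ 2) + 2 * (x * y)); last by ring.
  rewrite xy.
  by move: (x * y) P0 P1 => P P0 P1; nra.
have P2 : (x * y) ^+ 2 <= (x * y) / 2 by move: (x * y) P0 P1 => P P0 P1; nra.
(* Cauchy-Schwarz on the unit circle. The coefficient of x y left by [P2] and [slb] is 39/25 -
   (6/5)(207/250) = 354/625, and 9/25 x^2 comes from (9/50)(x^2 - y^2). *)
have lin : (354/625) * y + (9/25) * x <= 84/125.
  rewrite -(@ler_pXn2r _ 2) ?nnegrE; [|by []|lra|lra].
  by have := sqr_ge0 ((354/625) * x - (9/25) * y); lra.
have -> : x ^+ 4 - 6 * x ^+ 2 * y ^+ 2 + y ^+ 4 = 1 - 8 * (x * y) ^+ 2.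
  have -> : y ^+ 4 = (1 - x ^+ 2) ^+ 2 by rewrite -y2; ring.
  by rewrite exprMn y2; ring.
have : x * ((354/625) * y + (9/25) * x - 13/20) <= 22/1000.
  have lin' : (354/625) * y + (9/25) * x - 13/20 <= 22/1000 by lra.
  have := ler_wpM2l x0 lin'; lra.
lra.
Qed.
End numerics.

(** * The quadratic form of the weight on each arc *)

Section weights.
Context {R : realType}.
Implicit Types (alpha beta psi gamma : R[i]) (eps k : R).

Definition arc_phase alpha (j : nat) : R[i] :=
  match j with
  | 1%N => alpha | 2%N => - alpha^* | 3%N => - alpha | _ => alpha^*
  end.

Definition arc_scale eps (j : nat) : R :=
  if (j == 2) || (j == 3) then (1 - eps ^+ 2)^-1 else 1.

Lemma deltaN alpha : delta (- alpha) = - delta alpha.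
Proof.
apply/matrixP => i j; rewrite !mxE rmorphN.
by case: ifP => // _; case: ifP => // _; rewrite oppr0.
Qed.

Lemma conj_delta alpha : map_mx conjc (delta alpha) = delta alpha^*.
Proof.
apply/matrixP => i j; rewrite !mxE.
by case: ifP => // _; case: ifP => // _; rewrite conjc0.
Qed.

(** As [delta alpha] squares to I, the inverse is I - eps delta divided by 1 - eps^2; the minus sign
    is absorbed into the phase. *)
Lemma inv_delta alpha eps : `|alpha| = 1 -> 0 < eps < 1 ->
  invmx (1%:M + eps%:C *: delta alpha) =
  ((1 - eps ^+ 2)^-1)%:C *: (1%:M + eps%:C *: delta (- alpha)).
Proof.
move=> a1 e01; have [C Cu CE] := delta_gram a1 e01.
have e2 : 1 - eps ^+ 2 != 0.
  by case/andP: e01 => e0 e1; rewrite gt_eqF // subr_gt0 expr_lt1 // ltW.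
have Au : 1%:M + eps%:C *: delta alpha \in unitmx.
  by rewrite CE unitmx_mul Cu unitmx_tr map_unitmx Cu.
rewrite -[LHS]mulmx1 -[RHS](mulKmx Au); congr (_ *m _).
have eE : 1 - eps%:C * eps%:C = (1 - eps ^+ 2)%:C :> R[i].
  by rewrite rmorphB rmorph1 expr2 rmorphM.
rewrite -scalemxAr deltaN scalerN -scaleNr -[X in (X + _) *m _]scale1r.
rewrite -[X in _ *m (X + _)]scale1r (mul_delta _ _ _ _ a1).
rewrite !mulr1 !mul1r mulrN addNr scale0r addr0 eE scalerA -rmorphM mulVf //.
by rewrite rmorph1 scale1r.
Qed.

Lemma weightE alpha eps j gamma : `|alpha| = 1 -> 0 < eps < 1 -> (1 <= j <= 4)%N ->
  quadrant_arc j gamma -> weight alpha eps gamma =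
    (arc_scale eps j)%:C *: (1%:M + eps%:C *: delta (arc_phase alpha j)).
Proof.
move=> a1 e01 j4 gj; rewrite /weight !(quadrant_arc_uniq _ _ gj) //.
case: j j4 {gj} => [//|[|[|[|[|//]]]]] _ //=; rewrite /arc_scale /=.
- by rewrite scale1r.
- by rewrite conj_delta inv_delta ?normcJ.
- by rewrite inv_delta.
- by rewrite scale1r conj_delta.
Qed.

Lemma norm_arc_phase alpha j : `|alpha| = 1 -> `|arc_phase alpha j| = 1.
Proof. by move=> a1; case: j => [|[|[|[|j]]]] /=; rewrite ?normrN ?normcJ. Qed.

Lemma ellnorm_weight psi eps k (x : 'cV[R[i]]_2) : `|psi| = 1 -> 0 < eps < 1 -> 0 <= k ->
  ellnorm (sqrtmx (k%:C *: (1%:M + eps%:C *: delta psi))) x ^+ 2 =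
  k * (normc (x 0 0) ^+ 2 + normc (x 1 0) ^+ 2
       + 2 * eps * complex.Re (conjc (x 1 0) * psi * x 0 0)).
Proof.
move=> p1 e01 k0; have [C _ CE] := delta_gram p1 e01.
have adjZ : adjmx ((Num.sqrt k)%:C *: C) = (Num.sqrt k)%:C *: adjmx C.
  by apply/matrixP => i j; rewrite !mxE rmorphM; congr (_ * _); exact: conjc_real.
have kE : k%:C *: (1%:M + eps%:C *: delta psi) =
    adjmx ((Num.sqrt k)%:C *: C) *m ((Num.sqrt k)%:C *: C).
  by rewrite CE adjZ -scalemxAl -scalemxAr scalerA -rmorphM -expr2 sqr_sqrtr.
rewrite kE ellnorm_sqrtmx; apply: (@complexI R); rewrite ellnormE -kE.
rewrite -scalemxAr -scalemxAl mxE rmorphM; congr (_ * _).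
rewrite !mxE !big_ord_recr big_ord0 /= !mxE !big_ord_recr !big_ord0 /= !mxE /= !add0r.
rewrite (_ : widen_ord _ _ = 0); last exact/val_inj.
rewrite (_ : ord_max = 1); last exact/val_inj.
rewrite !(mulr1, mulr0, addr0, add0r) !rmorphD /= !normc_sqr.
case: (x 0 0) => a b; case: (x 1 0) => c d; case: psi {p1 CE kE} => u v /=.
by simpc; congr (_ +i* _); ring.
Qed.
End weights.

(** * The test function and its norm on the circle *)

Section test_function.
Context {R : realType}.
Implicit Types (eps x y : R).

Definition rthalf : R := Num.sqrt (1/2).
Definition phase : R[i] := rthalf +i* rthalf.

Lemma rthalf_sqr : rthalf ^+ 2 = 1/2.
Proof. by rewrite sqr_sqrtr //; lra. Qed.

Lemma norm_phase : `|phase| = 1.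
Proof.
rewrite -normc_normr /= rthalf_sqr (_ : 1/2 + 1/2 = 1 :> R) ?sqrtr1 //.
by field.
Qed.

(* [2 Re corrector] is a trigonometric polynomial of mean zero which lies below
   [6/5 (|cos t| + |sin t|) - 18/25 - w] on the circle, where [w] is 0 on the
   right and 1 on the left half plane. The right-hand side has positive mean;
   the coefficients were found numerically. *)
Definition corrector : {poly R[i]} :=
  (13/40)%:C *: 'X + (9/100)%:C *: 'X^2 - (39/200)%:C *: 'X^4.

Lemma horner_corrector z : corrector.[z] =
  (13/40)%:C * z + (9/100)%:C * z ^+ 2 - (39/200)%:C * z ^+ 4.
Proof. by rewrite !(hornerD, hornerN, hornerZ, hornerX, hornerXn). Qed.

Lemma corrector_norm z : normc z = 1 -> normc corrector.[z] <= 1.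
Proof.
move=> z1; rewrite horner_corrector.
have zn n : normc (z ^+ n) = 1.
  by elim: n => [|n ih]; rewrite ?expr0 ?normc1 // exprS normcM z1 ih mulr1.
apply: (le_trans (le_normcD _ _)); rewrite normcN.
apply: (@le_trans _ _ (13/40 + 9/100 + 39/200)); last by lra.
apply: lerD; last by rewrite normcM zn mulr1 normc_real ger0_norm; lra.
apply: (le_trans (le_normcD _ _)).
by rewrite (normcM (13/40)%:C) (normcM (9/100)%:C) zn z1 !mulr1 !normc_real !ger0_norm; lra.
Qed.

Lemma Re_corrector x y : complex.Re corrector.[x +i* y] =
  (13/40) * x + (9/100) * (x ^+ 2 - y ^+ 2)
    - (39/200) * (x ^+ 4 - 6 * x ^+ 2 * y ^+ 2 + y ^+ 4).
Proof. by rewrite horner_corrector !exprS expr0 /=; ring. Qed.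

(* [6/5 * rthalf], about 0.85, is close to the optimal [2 sqrt 2 / pi], the
   first Fourier coefficient of the function [arc_phase phase] of the angle. *)
Definition test_poly eps (i : 'I_2) : {poly R[i]} :=
  if i == 0 then 1 + (eps ^+ 2)%:C *: corrector
  else (- (6/5 * rthalf * eps))%:C *: 'X.

Lemma test_poly_at0 eps : polymap (test_poly eps) 0 = delta_mx 0 0.
Proof.
apply/colP => i; rewrite !mxE /test_poly andbT.
by case: eqP => _; rewrite !hornerE /= ?expr0n /= ?mulr0 ?subr0 ?addr0 ?mulr0 ?addr0.
Qed.

(** Expand in e = eps^2. The coefficient of e is at most -1/50 - w by assumption, that of e^2 is at
    most 14/5 by [T], and (14/5)/400 < 1/100, so half of the margin survives. *)
Lemma second_order_bound (A B g1 g2 e w : R) : A ^+ 2 + B ^+ 2 = 2 ->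
  g1 ^+ 2 + g2 ^+ 2 <= 1 -> 0 <= e -> e <= 1/400 ->
  2 * g1 + 18/25 - (6/5) * A + w <= - (1/50) ->
  (1 + e * g1) ^+ 2 + (e * g2) ^+ 2 + 18/25 * e
    - (6/5) * e * (A * (1 + e * g1) - B * (e * g2)) <= 1 - w * e - e / 100.
Proof.
move=> AB g12 e0 e1 h.
have T : g1 ^+ 2 + g2 ^+ 2 - (6/5) * (A * g1 - B * g2) <= 14/5.
  by have := sqr_ge0 (A + g1); have := sqr_ge0 (B - g2); lra.
have eT := ler_wpM2l (mulr_ge0 e0 e0) T.
have eh := ler_wpM2l e0 h.
have ee := ler_wpM2l e0 e1.
lra.
Qed.

Lemma test_form_value eps x y g1 g2 (s1 s2 : R) : x ^+ 2 + y ^+ 2 = 1 ->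
  let f0 := 1 + (eps ^+ 2)%:C * (g1 +i* g2) : R[i] in
  let f1 := (- (6/5 * rthalf * eps))%:C * (x +i* y) : R[i] in
  normc f0 ^+ 2 + normc f1 ^+ 2
    + 2 * eps * complex.Re (conjc f1 * ((s1 * rthalf) +i* (s2 * rthalf)) * f0) =
  (1 + eps ^+ 2 * g1) ^+ 2 + (eps ^+ 2 * g2) ^+ 2 + 18/25 * eps ^+ 2
    - (6/5) * eps ^+ 2 * ((s1 * x + s2 * y) * (1 + eps ^+ 2 * g1)
                          - (s2 * x - s1 * y) * (eps ^+ 2 * g2)).
Proof.
move=> xy f0 f1.
have f0E : f0 = (1 + eps ^+ 2 * g1) +i* (eps ^+ 2 * g2).
  by rewrite /f0; simpc; congr (_ +i* _); ring.
have f1E : f1 = (- (6/5 * rthalf * eps * x)) +i* (- (6/5 * rthalf * eps * y)).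
  by rewrite /f1; simpc; congr (_ +i* _); ring.
rewrite f0E f1E; set a := 1 + _ * g1; set b := _ * g2.
rewrite /= !sqr_sqrtr ?addr_ge0 ?sqr_ge0 //.
transitivity (a ^+ 2 + b ^+ 2 + 36/25 * rthalf ^+ 2 * eps ^+ 2 * (x ^+ 2 + y ^+ 2)
    - (12/5) * rthalf ^+ 2 * eps ^+ 2 * ((s1 * x + s2 * y) * a - (s2 * x - s1 * y) * b)).
  by field.
by rewrite xy rthalf_sqr; field.
Qed.

(** The signs [s1] and [s2] are those of cos t and sin t on the arc, so s1 cos t + s2 sin t = |cos
    t| + |sin t|. As Re [corrector] is even in sin t, the upper and lower arcs share a bound. *)
Lemma arc_phaseP j : (1 <= j <= 4)%N -> exists s1 s2 : R,
  [/\ arc_phase phase j = (s1 * rthalf) +i* (s2 * rthalf), s1 ^+ 2 = 1, s2 ^+ 2 = 1 &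
    forall t, quadrant_arc j (cis t) ->
    2 * complex.Re corrector.[cis t] + 18/25 - (6/5) * (s1 * cos t + s2 * sin t)
      + (if (j == 2) || (j == 3) then 1 else 0) <= - (1/50)].
Proof.
have right x y := @right_arc_bound R x y; have left x y := @left_arc_bound R x y.
have cs t := @cos2Dsin2 R t.
have sqN1 : (-1) ^+ 2 = 1 :> R by rewrite sqrrN expr1n.
move=> j4; move: (j4); case: j j4 => [//|[|[|[|[|//]]]]] _ j4.
- exists 1, 1; split; [by apply/eqP; rewrite eq_complex /= ?mul1r ?mulN1r ?opprK !eqxx
    |exact: expr1n|exact: expr1n|].
  move=> t /(quadrant_arcP j4) /andP[/ltW x0 /ltW y0]; rewrite Re_corrector /=.
  by have := right (cos t) (sin t) x0 y0 (cs t); lra.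
- exists (-1), 1; split; [by apply/eqP; rewrite eq_complex /= ?mul1r ?mulN1r ?opprK !eqxx
    |exact: sqN1|exact: expr1n|].
  move=> t /(quadrant_arcP j4) /andP[x0 /ltW y0]; rewrite Re_corrector /=.
  have {}x0 : 0 <= - cos t by move: x0 => /=; lra.
  by have := left (- cos t) (sin t) x0 y0; rewrite sqrrN cs => /(_ erefl); lra.
- exists (-1), (-1); split; [by apply/eqP; rewrite eq_complex /= ?mul1r ?mulN1r ?opprK !eqxx
    |exact: sqN1|exact: sqN1|].
  move=> t /(quadrant_arcP j4) /andP[x0 y0]; rewrite Re_corrector /=.
  have {}x0 : 0 <= - cos t by move: x0 => /=; lra.
  have {}y0 : 0 <= - sin t by move: y0 => /=; lra.
  by have := left (- cos t) (- sin t) x0 y0; rewrite !sqrrN cs => /(_ erefl); lra.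
- exists 1, (-1); split; [by apply/eqP; rewrite eq_complex /= ?mul1r ?mulN1r ?opprK !eqxx
    |exact: expr1n|exact: sqN1|].
  move=> t /(quadrant_arcP j4) /andP[/ltW x0 y0]; rewrite Re_corrector /=.
  have {}y0 : 0 <= - sin t by move: y0 => /=; lra.
  by have := right (cos t) (- sin t) x0 y0; rewrite sqrrN cs => /(_ erefl); lra.
Qed.

Lemma Zfam_test_le eps j t : 0 < eps -> eps < 1/20 -> (1 <= j <= 4)%N ->
  quadrant_arc j (cis t) ->
  Zfam phase eps (cis t) (polymap (test_poly eps) (cis t)) <= Num.sqrt (1 - eps ^+ 2 / 100).
Proof.
move=> e0 e1 j4 gj; have e01 : 0 < eps < 1 by rewrite e0; lra.
have e2 : eps ^+ 2 <= 1/400.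
  by rewrite (_ : 1/400 = (1/20) ^+ 2); [rewrite lerXn2r ?nnegrE; lra | field].
have e2' : 0 < eps ^+ 2 by rewrite exprn_gt0.
rewrite (Zfam_weight _ norm_phase e01 j4 gj) -[leLHS](ger0_norm (l2norm_ge0 _)) -sqrtr_sqr.
rewrite ler_sqrt; last by lra.
have [s1 [s2 [psiE s11 s21 /(_ t gj) bound]]] := arc_phaseP j4.
have k0 : 0 <= arc_scale eps j.
  by rewrite /arc_scale; case: ifP => // _; rewrite invr_ge0; lra.
rewrite (weightE norm_phase e01 j4 gj) ellnorm_weight ?norm_arc_phase ?norm_phase //.
have -> : polymap (test_poly eps) (cis t) 0 0 = 1 + (eps ^+ 2)%:C * corrector.[cis t].
  by rewrite mxE /test_poly eqxx -polyC1 hornerD hornerC hornerZ.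
have -> : polymap (test_poly eps) (cis t) 1 0 = (- (6/5 * rthalf * eps))%:C * cis t.
  by rewrite mxE /test_poly /= hornerZ hornerX.
have := corrector_norm (normc_cis t); move: bound.
case: (corrector.[cis t]) => g1 g2 /= bound g12.
rewrite psiE test_form_value; last exact: cos2Dsin2.
have AB : (s1 * cos t + s2 * sin t) ^+ 2 + (s2 * cos t - s1 * sin t) ^+ 2 = 2.
  transitivity ((s1 ^+ 2 + s2 ^+ 2) * (cos t ^+ 2 + sin t ^+ 2)); first by ring.
  by rewrite s11 s21 cos2Dsin2; field.
have g12' : g1 ^+ 2 + g2 ^+ 2 <= 1.
  by move: g12; rewrite -[X in _ <= X]sqrtr1 ler_sqrt.
have := second_order_bound AB g12' (ltW e2') e2 bound.
set N := (X in X <= _); rewrite -/N; move: N => N.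
rewrite /arc_scale; case: ifP => _ NE; last by lra.
(* On the left arcs w = 1 pays for the scale: with e = eps^2, 1 - e - e/100 is at most (1 - e)(1 -
   e/100). *)
rewrite mulrC ler_pdivrMr; last by lra.
have := mulr_ge0 (ltW e2') (ltW e2'); lra.
Qed.
End test_function.

(** * The bound on the interpolation norm of e1 *)

Section main.
Context {R : realType}.
Implicit Types (eps t : R).
Local Open Scope classical_set_scope.

Lemma arc_negligible1 (a : R) : (@arc_measure R).-negligible [set a].
Proof.
exists [set a]; split => //; apply/eqP; rewrite eq_le measure_ge0 andbT.
rewrite -(lebesgue_measure_set1 a) /arc_measure /mrestr.
apply: le_measure; [apply/mem_set|apply/mem_set|exact: subIsetl].
  by apply: measurableI; [exact: measurable_set1 | exact: measurable_itv].
exact: measurable_set1.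
Qed.

Lemma arc_negligibleC : (@arc_measure R).-negligible (~` `]0, 2 * pi[).
Proof.
exists (~` `]0, 2 * pi[); split => //; first exact: measurableC.
by rewrite /arc_measure /= /mrestr setICl measure0.
Qed.

(** Almost everywhere refers to the whole line, so the exceptional set consists of the complement of
    ]0, 2 pi[, where the measure vanishes, and the three inner endpoints. *)
Lemma ae_quadrant_arc :
  {ae @arc_measure R, forall t : measurableTypeR R,
    exists2 j, (1 <= j <= 4)%N & quadrant_arc j (cis t)}.
Proof.
have : (@arc_measure R).-negligible
    (~` `]0, 2 * pi[ `|` [set pi / 2] `|` [set pi] `|` [set 3 * pi / 2]).
  do 3 (apply: negligibleU; last exact: arc_negligible1).
  exact: arc_negligibleC.
apply: negligibleS => t /= nt.
case: (boolP (t == pi / 2)) => [/eqP ->|t1]; first by left; left; right.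
case: (boolP (t == pi)) => [/eqP ->|t2]; first by left; right.
case: (boolP (t == 3 * pi / 2)) => [/eqP ->|t3]; first by right.
left; left; left => /=; rewrite in_itv /= => /andP[t0 t4]; apply: nt.
have arc j : (j%:R - 1) * pi / 2 < t -> t < j%:R * pi / 2 -> quadrant_arc j (cis t).
  by move=> ? ?; exists t => //=; rewrite in_itv /=; apply/andP.
have [t1'|t1'|/eqP] := ltgtP t (pi / 2); last by rewrite (negPf t1).
  by exists 1%N => //; apply: arc; lra.
have [t2'|t2'|/eqP] := ltgtP t pi; last by rewrite (negPf t2).
  by exists 2%N => //; apply: arc; lra.
have [t3'|t3'|/eqP] := ltgtP t (3 * pi / 2); last by rewrite (negPf t3).
  by exists 3%N => //; apply: arc; lra.
by exists 4%N => //; apply: arc; lra.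
Qed.

Lemma interp0_Zfam_le eps : 0 < eps -> eps < 1/20 ->
  (interp0 (Zfam phase eps) (delta_mx 0%R 0%R) <= (Num.sqrt (1 - eps ^+ 2 / 100)%R)%:E)%E.
Proof.
move=> e0 e1; set f := polymap (test_poly eps).
apply: (@le_trans _ _ (ess_sup (@arc_measure R)
    (fun t : measurableTypeR R => (Zfam phase eps (cis t) (f (cis t)))%:E))).
  apply: ereal_inf_lbound; exists f, f; split => //.
  - exact: polymap_analytic.
  - exact: polymap_bounded.
  - exact: polymap_boundary.
  - exact: test_poly_at0.
apply/ess_supP; apply: filterS ae_quadrant_arc => t [j j4 gj].
by rewrite lee_fin (Zfam_test_le e0 e1 j4 gj).
Qed.

Lemma l2norm_delta : l2norm (delta_mx 0 0 : 'cV[R[i]]_2) = 1.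
Proof.
rewrite /l2norm !big_ord_recr big_ord0 /= !mxE /=.
by rewrite !expr0n !expr1n /= !addr0 sqrtr0 sqrtr1 expr0n expr1n /= addr0 add0r sqrtr1.
Qed.
End main.

Local Close Scope complex_scope.
Unset Implicit Arguments.

Theorem proposition4p7 (R : realType) :
  (forall (alpha : R[i]) (eps : R), `|alpha| = 1 -> 0 < eps < 1 ->
     forall j : nat, (1 <= j <= 4)%N ->
     forall gamma : R[i], quadrant_arc j gamma ->
     forall x : 'cV[R[i]]_2,
       Zfam alpha eps gamma x = ellnorm (sqrtmx (weight alpha eps gamma)) x) /\
  (exists alpha : R[i], `|alpha| = 1 /\
     exists eps0 : R, 0 < eps0 < 1 /\
       forall eps : R, 0 < eps -> eps < eps0 ->
         exists x : 'cV[R[i]]_2,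
           interp0 (Zfam alpha eps) x <> (l2norm x)%:E).
Proof.
split=> [alpha eps a1 e01 j j4 gamma gj x|]; first exact: Zfam_weight gj.
exists phase; split; first exact: norm_phase.
(* Below 1/20 one has eps^2 <= 1/400, as [second_order_bound] requires. *)
exists (1/20); split=> [|eps e0 e1]; first by lra.
exists (delta_mx 0 0); apply/eqP; rewrite lt_eqF // l2norm_delta.
apply: (le_lt_trans (interp0_Zfam_le e0 e1)).
have e2 : 0 < eps ^+ 2 by rewrite exprn_gt0.
by rewrite lte_fin -[ltRHS]sqrtr1 ltr_sqrt; lra.
Qed.
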